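(* Let $G$ be a finite group, $Y\subset G$ a non-empty subset, and $f:G\to\mathbb{C}$ a function. Then $$|I(f)-I_Y(f)|\le \sum_{\rho\in\widehat{G}\setminus\{1_G\}}\|f_\rho\|\,\partial_\rho(Y)\le V(f)\,D(Y),$$ where $$V(f):=\sum_{\rho\in\widehat{G}\setminus\{1_G\}}\|f_\rho\|\dim\rho,\qquad D(Y):=\max_{\rho\in\widehat{G}\setminus\{1_G\}}\frac{\partial_\rho(Y)}{\dim\rho}.$$
   Context: $\mathbb{C}^G$ is the space of functions $G\to\mathbb{C}$, with inner product $\langle f,g\rangle=\sum_{x\in G}f(x)\overline{g(x)}$ and norm $\|f\|=\sqrt{\langle f,f\rangle}$. For $f\in\mathbb{C}^G$, $I(f)=\frac1{\#G}\sum_{x\in G}f(x)$ and $I_Y(f)=\frac1{\#Y}\sum_{x\in Y}f(x)$. $\widehat{G}$ is the set of isomorphism classes of irreducible complex representations of $G$; $\chi_\rho$ and $\dim\rho$ denote the character and dimension of $\rho\in\widehat G$; $1_G$ is the trivial representation. $\mathbb{C}^G$ is a left $G$-module via $(gf)(x)=f(g^{-1}x)$, and decomposes orthogonally as $\mathbb{C}^G=\bigoplus_{\rho\in\widehat{G}}V_\rho$ with $V_\rho$ the $\rho$-isotypic component; $f_\rho\in V_\rho$ denotes the $\rho$-component of $f$. For $\rho\in\widehat{G}$, $$\partial_\rho(Y):=\sqrt{\frac{\dim\rho}{(\#Y)^2\,\#G}\sum_{x,y\in Y}\chi_\rho(x^{-1}y)},$$ where the quantity under the square root is a non-negative real number.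 *)

(* Defs.v *)
From HB Require Import structures.
From mathcomp Require Import all_boot all_order all_algebra all_fingroup.
From mathcomp Require Import mxrepresentation.
From mathcomp Require Import complex.
From mathcomp Require Import boolp classical_sets reals.

Set Implicit Arguments.
Unset Strict Implicit.
Unset Printing Implicit Defensive.

Import Order.TTheory GRing.Theory Num.Theory.
Local Open Scope ring_scope.
Local Open Scope complex_scope.

(* C^G with G = gT; the ^o only selects the C-vector space structure of C. *)
Notation fun_space R gT := {ffun gT -> R[i]^o}.

Section Quadrature.
Variables (R : realType) (gT : finGroupType).

Local Notation C := R[i].
Local Notation CG := (fun_space R gT).
Local Notation G := [set: gT]%G.

Definition inner (f g : CG) : C := \sum_(x : gT) (f x : C) * (g x : C)^*.

(* <f, f> is a nonnegative real. *)
Definition normf (f : CG) : R := Num.sqrt (complex.Re (inner f f)).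

Definition mean_on (Y : {set gT}) (f : CG) : C :=
  (#|Y|%:R : C)^-1 * \sum_(x in Y) (f x : C).

Definition mean (f : CG) : C := mean_on [set: gT] f.

(* The index type of a complete family, without repetition, of irreducible    *)
(* complex matrix representations of G up to similarity. For rho : dual,      *)
(* irr_repr rho is a matrix representation in that class, irr_degree rho its  *)
(* dimension, and [1 dual]%irr the index of the trivial representation.       *)
Definition dual : irrType C G := DecSocleType (regular_repr C G).

Definition chi (rho : dual) (g : gT) : C := \tr (irr_repr rho g).

Definition lact (g : gT) (f : CG) : CG := [ffun x => f (g^-1 * x)%g].

(* W is a submodule of the left G-module C^G isomorphic to rho. A matrix      *)
(* representation defines a left module on column vectors, g v := rho(g) v;   *)
(* mxrepresentation uses row vectors, which are right modules, so its         *)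
(* submodule theory is not used here.                                         *)
Definition submodule_of_type (rho : dual) (W : {vspace CG}) : Prop :=
  exists phi : 'Hom('cV[C]_(irr_degree rho), CG),
    [/\ lker phi = 0%VS,
        limg phi = W &
        forall (g : gT) (v : 'cV[C]_(irr_degree rho)),
          phi (irr_repr rho g *m v) = lact g (phi v)].

(* V is the sum of all the submodules of C^G isomorphic to rho, i.e., the     *)
(* least subspace containing all of them.                                     *)
Definition is_isotypic (rho : dual) (V : {vspace CG}) : Prop :=
  (forall W : {vspace CG}, submodule_of_type rho W -> (W <= V)%VS) /\
  (forall U : {vspace CG},
      (forall W : {vspace CG}, submodule_of_type rho W -> (W <= U)%VS) ->
      (V <= U)%VS).

(* The default value 0 is never used, by isotypicP.                           *)
Definition isotypic (rho : dual) : {vspace CG} :=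
  xget 0%VS [set V | is_isotypic rho V]%classic.

Lemma isotypicP (rho : dual) : is_isotypic rho (isotypic rho).
Proof.
suff [V hV] : exists V, is_isotypic rho V.
  by rewrite /isotypic; case: xgetP => [W _ //|/(_ V)].
pose ok (V : {vspace CG}) := forall U : {vspace CG},
  (forall W, submodule_of_type rho W -> (W <= U)%VS) -> (V <= U)%VS.
pose P n := `[< exists2 V, ok V & \dim V = n >].
have exP : exists n, P n by exists 0%N; apply/asboolP; exists 0%VS;
  [move=> U _; exact: sub0v | exact: dimv0].
have leP n : P n -> (n <= \dim {:CG})%N.
  by move=> /asboolP[V _ <-]; rewrite dimvS ?subvf.
case: (ex_maxnP exP leP) => n /asboolP[V okV dV] maxV.
exists V; split=> // W hW.
have okVW : ok (V + W)%VS by move=> U hU; rewrite subv_add okV // hU.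
have VW : (V == V + W)%VS.
  rewrite eqEdim addvSl dV /=; apply: maxV; apply/asboolP.
  by exists (V + W)%VS.
by rewrite (eqP VW) addvSr.
Qed.

(* f_rho: the projection of f to the summand V_rho of (+)_rho V_rho = C^G.    *)
Definition component (rho : dual) (f : CG) : CG :=
  sumv_pi (\sum_(sigma : dual) isotypic sigma)%VS rho f.

(* The quantity under the square root is a nonnegative real.                  *)
Definition boundary (rho : dual) (Y : {set gT}) : R :=
  Num.sqrt (complex.Re
    ((irr_degree rho)%:R / (#|Y|%:R ^+ 2 * #|gT|%:R)
     * \sum_(x in Y) \sum_(y in Y) chi rho (x^-1 * y)%g)).

Definition variation (f : CG) : R :=
  \sum_(rho : dual | rho != [1 dual]%irr)
     normf (component rho f) * (irr_degree rho)%:R.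

(* All the values are nonnegative, so the initial value 0 of the maximum only *)
(* matters when G is trivial, where it makes the maximum over the empty set 0.*)
Definition discrepancy (Y : {set gT}) : R :=
  \big[Num.max/0]_(rho : dual | rho != [1 dual]%irr)
     (boundary rho Y / (irr_degree rho)%:R).

End Quadrature.

Arguments dual R gT : clear implicits.

(* Main.v *)
Require Import Defs.
From HB Require Import structures.
From mathcomp Require Import all_boot all_order all_algebra all_fingroup.
From mathcomp Require Import sesquilinear spectral pgroup.
From mathcomp Require Import mxrepresentation complex reals.
From mathcomp Require Import ring.

(** The averaging operator
      P_rho f (x) = dim rho / #G * sum_y chi_rho (y x^-1) f(y)
    is the projection of C^G onto V_rho: the Schur orthogonality relations
    give P_rho = delta_(rho, sigma) on V_sigma (isoproj_isotypic), P_rho f is a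
    combination of matrix coefficients of rho, hence lies in V_rho
    (isoproj_in_isotypic), and the P_rho f add up to f because the character
    of the regular representation, sum_rho (dim rho) chi_rho, is #G times the
    indicator function of 1 (sum_isoproj). Therefore f_rho = P_rho f
    (component_isoproj).

    For rho = 1_G this component is the constant I(f), so that
      I(f) - I_Y(f) = - sum_(rho != 1_G) I_Y(f_rho)     (mean_sub_mean_on)
    and it remains to bound each term. Let 1_Y be the indicator function of Y.
    As P_rho is idempotent and, since chi_rho (g^-1) is the conjugate of
    chi_rho (g), self-adjoint,
      #Y I_Y(f_rho) = <f_rho, 1_Y> = <f_rho, P_rho 1_Y>,
    which by Cauchy-Schwarz is at most ||f_rho|| ||P_rho 1_Y|| in absolute
    value. Finally
      ||P_rho 1_Y||^2 = <P_rho 1_Y, 1_Y>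
        = dim rho / #G * sum_(x, y in Y) chi_rho (x^-1 y)
        = (#Y * boundary rho Y)^2                       (normf_isoproj_indic),
    whence the first inequality (mean_component_le). The second one bounds each
    boundary rho Y / dim rho by its maximum. *)

Set Implicit Arguments.
Unset Strict Implicit.
Unset Printing Implicit Defensive.

Import Order.TTheory GRing.Theory Num.Theory.
Local Open Scope ring_scope.
Local Open Scope complex_scope.

(** * Schur orthogonality *)

Section Schur.
Variables (F : fieldType) (gT : finGroupType) (G : {group gT}).
Variables (n1 n2 : nat).
Variables (rG1 : mx_representation F G n1) (rG2 : mx_representation F G n2).

Definition intertwines (A : 'M[F]_(n1, n2)) :=
  {in G, forall x, rG1 x *m A = A *m rG2 x}.

(** Schur's lemma: the kernel and the image of [A] are submodules, so the first
    is zero and the second is everything. *)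
Lemma intertwiner_rsim (A : 'M_(n1, n2)) :
    mx_irreducible rG1 -> mx_irreducible rG2 -> intertwines A -> A != 0 ->
  mx_rsim rG1 rG2.
Proof.
move=> /mx_irrP[_ irr1] /mx_irrP[_ irr2] homA nzA.
have kerA0 : kermx A == 0.
  apply: contraR nzA => /irr1 fullK; rewrite -[A]mul1mx.
  apply/eqP/sub_kermxP; rewrite sub1mx fullK //.
  apply/mxmoduleP=> x Gx; apply/sub_kermxP.
  by rewrite -mulmxA homA // mulmxA mulmx_ker mul0mx.
have freeA : row_free A by rewrite -kermx_eq0.
have fullA : row_full A.
  have -> : row_full A = row_full <<A>>%MS by rewrite /row_full genmxE.
  apply: irr2; last by rewrite -mxrank_eq0 genmxE mxrank_eq0.
  apply/mxmoduleP=> x Gx; rewrite (eqmxMr _ (genmxE A)) genmxE.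
  by rewrite -homA // submxMl.
by exists A => //; rewrite -(eqP freeA) (eqP fullA).
Qed.

(** Averaging an arbitrary matrix over the group makes it an intertwiner. *)
Definition avg_mx (E : 'M[F]_(n1, n2)) : 'M[F]_(n1, n2) :=
  \sum_(x in G) rG1 x^-1%g *m E *m rG2 x.

Lemma avg_mx_intertwines E : intertwines (avg_mx E).
Proof.
move=> y Gy; rewrite /avg_mx mulmx_sumr mulmx_suml.
rewrite (reindex_acts 'R _ Gy) ?astabsR //=.
apply: eq_bigr => x Gx; rewrite !mulmxA -repr_mxM ?groupV ?groupM //.
by rewrite -[RHS]mulmxA -repr_mxM // invMg mulKVg.
Qed.

(** Reduces the orthogonality relations to the averages of the elementary
    matrices, to which Schur's lemma applies. *)
Lemma sum_mxtraceV_entry i j :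
  (\sum_(x in G) \tr (rG1 x^-1%g) *: rG2 x) i j
    = \sum_k avg_mx (delta_mx k i) k j.
Proof.
rewrite summxE; under eq_bigr => x Gx do rewrite !mxE /mxtrace mulr_suml.
rewrite exchange_big; apply: eq_bigr => k _ /=; rewrite summxE.
apply: eq_bigr => x Gx; rewrite mxE (bigD1 i) //= big1 ?addr0 => [|l ne_li].
  rewrite mxE (bigD1 k) //= big1 ?addr0 => [|l ne_lk].
    by rewrite mxE !eqxx mulr1.
  by rewrite mxE (negPf ne_lk) mulr0.
rewrite mxE big1 ?mul0r // => l' _.
by rewrite mxE (negPf ne_li) andbF mulr0.
Qed.

End Schur.

Lemma sum_mxtraceV_not_rsim (F : fieldType) (gT : finGroupType) (G : {group gT})
    (n1 n2 : nat) (rG1 : mx_representation F G n1)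
    (rG2 : mx_representation F G n2) :
    mx_irreducible rG1 -> mx_irreducible rG2 -> ~ mx_rsim rG1 rG2 ->
  \sum_(x in G) \tr (rG1 x^-1%g) *: rG2 x = 0.
Proof.
move=> irr1 irr2 non_iso; apply/matrixP=> i j.
rewrite sum_mxtraceV_entry big1 ?mxE // => k _.
have [-> | nzA] := eqVneq (avg_mx rG1 rG2 (delta_mx k i)) 0.
  by rewrite mxE.
case: non_iso; apply: intertwiner_rsim nzA => //; exact: avg_mx_intertwines.
Qed.

(** The average of an elementary matrix commutes with [rG], so it is a scalar,
    which its trace determines. *)
Lemma sum_mxtraceV_abs_irr (F : fieldType) (gT : finGroupType) (G : {group gT})
    (n : nat) (rG : mx_representation F G n) :
    mx_absolutely_irreducible rG ->
  n%:R *: (\sum_(x in G) \tr (rG x^-1%g) *: rG x) = #|G|%:R%:M.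
Proof.
move=> absG; apply/matrixP=> i j; rewrite mxE sum_mxtraceV_entry mulr_sumr.
have avgE k : n%:R * avg_mx rG rG (delta_mx k i) k j
                = (#|G|%:R *+ (k == i)) *+ (k == j).
  have /is_scalar_mxP[c defA] : is_scalar_mx (avg_mx rG rG (delta_mx k i)).
    apply: (mx_abs_irr_cent_scalar absG); apply/centgmxP=> x Gx.
    exact/esym/avg_mx_intertwines.
  have trA : \tr (avg_mx rG rG (delta_mx k i)) = #|G|%:R *+ (k == i).
    rewrite raddf_sum /= -sum1_card natr_sum -sumrMnl; apply: eq_bigr => x Gx.
    rewrite mxtrace_mulC mulmxA -repr_mxM ?groupV // mulgV repr_mx1 mul1mx.
    rewrite /mxtrace; have [-> | ne_ki] := eqVneq k i; last first.
      apply: big1 => l _; rewrite mxE; case: eqP => //= ->.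
      by rewrite (negPf ne_ki).
    rewrite (bigD1 i) //= big1 ?addr0 ?mxE ?eqxx // => l ne_li.
    by rewrite mxE (negPf ne_li).
  by rewrite -trA defA mxtrace_scalar mxE mulr_natl mulrnAC.
under eq_bigr do rewrite avgE.
rewrite (bigD1 i) //= big1 ?addr0 => [|k /negPf ne_ki].
  by rewrite eqxx mxE.
by rewrite ne_ki mul0rn.
Qed.

(** * Conjugate characters and the Cauchy-Schwarz inequality *)

(** The unitary trick: [rG x] preserves the positive definite Hermitian form
    [H], hence its inverse is conjugate through [H] to its adjoint and has the
    same trace. *)
Lemma mxtrace_reprV (C : numClosedFieldType) (gT : finGroupType)
    (G : {group gT}) (n : nat) (rG : mx_representation C G n) (x : gT) :
  x \in G -> \tr (rG x^-1%g) = Num.conj (\tr (rG x)).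
Proof.
pose adj m p (A : 'M[C]_(m, p)) := (map_mx Num.conj A)^T.
have adjM m p q (A : 'M_(m, p)) (B : 'M_(p, q)) :
    adj m q (A *m B) = adj p q B *m adj m p A.
  by rewrite /adj map_mxM trmx_mul.
pose H := \sum_(y in G) rG y^-1%g *m adj n n (rG y^-1%g).
have H_inv z : z \in G -> rG z *m H *m adj n n (rG z) = H.
  move=> Gz; rewrite mulmx_sumr mulmx_suml (reindex_acts 'R _ Gz) ?astabsR //=.
  apply: eq_bigr => y Gy; rewrite -!mulmxA -adjM mulmxA.
  by rewrite -repr_mxM ?groupV ?groupM // invMg mulKVg.
have unitH : H \in unitmx.
  rewrite -row_free_unit -kermx_eq0; apply/rowV0P => v /sub_kermxP vH0.
  (* v H v^* is a sum of squares, whose terms at y = 1 add up to |v|^2. *)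
  have : (v *m H *m adj 1%N n v) 0 0 = 0 by rewrite vH0 mul0mx mxE.
  have normE y : (v *m (rG y *m adj n n (rG y)) *m adj 1%N n v) 0 0
      = \sum_k `|(v *m rG y) 0 k| ^+ 2.
    rewrite mulmxA -[_ *m _ *m adj _ _ v]mulmxA -adjM mxE.
    by apply: eq_bigr => k _; rewrite normCK !mxE.
  rewrite /H mulmx_sumr mulmx_suml summxE.
  under eq_bigr do rewrite normE.
  have sum_ge0 y : 0 <= \sum_k `|(v *m rG y^-1%g) 0 k| ^+ 2.
    by apply: sumr_ge0 => k _; rewrite exprn_ge0.
  move/psumr_eq0P/(_ _ (group1 G)) => /(_ (fun y _ => sum_ge0 y)).
  move/psumr_eq0P => sum0; apply/rowP => k; rewrite mxE.
  have /eqP := sum0 (fun k _ => exprn_ge0 2 (normr_ge0 _)) k isT.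
  by rewrite invg1 repr_mx1 mulmx1 expf_eq0 normr_eq0 => /eqP.
move=> Gx.
have -> : rG x^-1%g = H *m adj n n (rG x) *m invmx H.
  apply: (canRL (mulmxK unitH)); rewrite -[in LHS](H_inv x Gx).
  by rewrite -mulmxA mulmxA -repr_mxM ?groupV // mulVg repr_mx1 mul1mx.
by rewrite mxtrace_mulC mulKmx // mxtrace_tr trace_map_mx.
Qed.

Lemma CauchySchwarz_sum (C : numClosedFieldType) (I : finType) (f g : I -> C) :
  `|\sum_i f i * Num.conj (g i)| ^+ 2
    <= (\sum_i f i * Num.conj (f i)) * (\sum_i g i * Num.conj (g i)).
Proof.
pose row (h : I -> C) : 'rV[C]_#|I| := \row_k h (enum_val k).
have rowE (h h' : I -> C) :
    dotmx (row h) (row h') = \sum_i h i * Num.conj (h' i).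
  rewrite dotmxE mxE (reindex _ (onW_bij _ (enum_val_bij I))) /=.
  by apply: eq_bigr => k _; rewrite !mxE.
by rewrite -!rowE; case: (CauchySchwarz (@dotmx C #|I|) (row f) (row g)).
Qed.

Section Norm.
Variables (R : realType) (gT : finGroupType).
Implicit Types f g : fun_space R gT.

Lemma normf_sqr f : ((normf f) ^+ 2)%:C = inner f f.
Proof.
have f_ge0 : 0 <= inner f f by apply: sumr_ge0 => x _; apply: mulcJ_ge0.
rewrite sqr_sqrtr ?RRe_real ?ger0_real //.
by move: f_ge0; rewrite lecE => /andP[].
Qed.

Lemma normf_ge0 f : 0 <= normf f.
Proof. exact: sqrtr_ge0. Qed.

Lemma inner_CauchySchwarz f g :
  `|inner f g| <= (normf f * normf g)%:C.
Proof.
rewrite -(@ler_pXn2r _ 2) ?nnegrE ?normr_ge0 ?ler0c ?mulr_ge0 ?normf_ge0 //.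
rewrite -[leRHS]rmorphXn exprMn rmorphM /= !normf_sqr.
exact: (@CauchySchwarz_sum R[i]).
Qed.

End Norm.

(** * Characters of the dual *)

Lemma mxtrace_mul_col (K : nzRingType) n (A B : 'M[K]_n) :
  \tr (A *m B) = \sum_k (A *m col k B) k 0.
Proof.
apply: eq_bigr => k _; rewrite !mxE.
by apply: eq_bigr => l _; rewrite mxE.
Qed.

Lemma mxtrace_repr_mulC (K : fieldType) (gT : finGroupType) (G : {group gT})
    (n : nat) (rG : mx_representation K G n) (x y : gT) :
  x \in G -> y \in G -> \tr (rG (x * y)%g) = \tr (rG (y * x)%g).
Proof. by move=> Gx Gy; rewrite !repr_mxM // mxtrace_mulC. Qed.

Section Isotypic.
Variables (R : realType) (gT : finGroupType).
Local Notation C := R[i].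
Local Notation CG := (fun_space R gT).
Local Notation G := [set: gT]%G.
Implicit Types (rho sigma : dual R gT) (f : CG) (Y : {set gT}).

(** Maschke's condition, which characteristic 0 makes vacuous. *)
Lemma complex_pchar'group : ([pchar C]^'.-group G)%g.
Proof. by apply/pgroupP=> p _ _; rewrite inE /= pchar_num. Qed.

Lemma complex_splitting_field : group_splitting_field C G.
Proof. exact: group_closure_closed_field. Qed.

Lemma dual_rsim_inj rho sigma :
  mx_rsim (irr_repr rho) (irr_repr sigma) -> rho = sigma.
Proof.
move=> rsim_rs; rewrite -(irr_reprK_pchar complex_pchar'group rho).
rewrite -(irr_reprK_pchar complex_pchar'group sigma).
exact: (irr_comp_rsim_pchar (dual R gT) complex_pchar'group rsim_rs).
Qed.

Lemma card_group_neq0 : #|gT|%:R != 0 :> C.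
Proof. by rewrite pnatr_eq0 -lt0n; apply/card_gt0P; exists 1%g. Qed.

Lemma chiC rho g h : chi rho (g * h)%g = chi rho (h * g)%g.
Proof. by apply: mxtrace_repr_mulC; rewrite in_setT. Qed.

Lemma chiV rho g : chi rho g^-1 = Num.conj (chi rho g).
Proof. by rewrite /chi mxtrace_reprV ?inE. Qed.

(** The central idempotent of [rho] acts on [sigma] as 1 or 0. *)
Lemma chi_orthogonality rho sigma :
  ((irr_degree rho)%:R / #|gT|%:R) *: (\sum_g chi rho g^-1 *: irr_repr sigma g)
    = (rho == sigma)%:R%:M.
Proof.
have -> : \sum_g chi rho g^-1 *: irr_repr sigma g
    = \sum_(g in G) \tr (irr_repr rho g^-1) *: irr_repr sigma g.
  by apply: eq_bigl => g; rewrite inE.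
have [<- | ne_rs] := eqVneq rho sigma; last first.
  rewrite sum_mxtraceV_not_rsim ?scaler0 ?raddf0 //; try exact: socle_irr.
  by move/dual_rsim_inj/eqP; rewrite (negPf ne_rs).
rewrite mulrC -scalerA sum_mxtraceV_abs_irr; last first.
  exact/complex_splitting_field/socle_irr.
by rewrite cardsT scale_scalar_mx mulVf ?card_group_neq0.
Qed.

(** The regular representation contains [rho] with multiplicity
    [irr_degree rho], and its character is supported at 1. *)
Lemma chi_regular g :
  \sum_(rho : dual R gT) (irr_degree rho)%:R / #|gT|%:R * chi rho g
    = (g == 1%g)%:R :> C.
Proof.
have /= tr_reg := mxtrace_regular_pchar (dual R gT) complex_pchar'group
  complex_splitting_field (in_setT g).
under eq_bigr => rho _ do
  rewrite [_ / _]mulrC -mulrA (mulr_natl (chi rho g)).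
rewrite -mulr_sumr.
have -> : \sum_(rho : dual R gT) chi rho g *+ irr_degree rho
    = \tr (regular_repr C G g).
  by rewrite tr_reg.
have [-> | ne_g1] := eqVneq g 1%g.
  by rewrite repr_mx1 mxtrace1 /gcard cardsT mulVf ?card_group_neq0.
rewrite /mxtrace big1 ?mulr0 // => i _; rewrite 2!mxE /=.
rewrite -(inj_eq enum_val_inj) gring_indexK ?groupM ?enum_valP ?inE //.
by rewrite eq_mulVg1 mulKg (negbTE ne_g1).
Qed.

(** * The projections onto the isotypic subspaces *)

Definition isoproj rho f : CG :=
  [ffun x =>
    (irr_degree rho)%:R / #|gT|%:R * \sum_y chi rho (y * x^-1)%g * f y].

Lemma isoproj_is_linear rho : linear (isoproj rho).
Proof.
move=> a f h; apply/ffunP=> x.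
have scaleE (z : C^o) : a *: z = a * z by [].
rewrite !ffunE scaleE mulrCA -mulrDr; congr (_ * _).
rewrite mulr_sumr -big_split; apply: eq_bigr => y _ /=.
by rewrite !ffunE scaleE mulrDr (mulrCA (chi _ _)).
Qed.

HB.instance Definition _ rho :=
  GRing.isLinear.Build C CG CG *:%R (isoproj rho) (isoproj_is_linear rho).

(** The same operator as the action of the central idempotent of [rho] on C^G;
    this is the form that intertwiners preserve. *)
Lemma isoproj_lact rho f :
  isoproj rho f =
    ((irr_degree rho)%:R / #|gT|%:R) *: \sum_g (chi rho g^-1 *: lact g f).
Proof.
apply/ffunP=> x; rewrite !ffunE; congr (_ * _).
rewrite sum_ffunE (reindex_inj (mulIg x)) (reindex_inj invg_inj) /=.
by apply: eq_bigr => g _; rewrite !ffunE mulgK.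
Qed.

(** The identity holds on the image of every intertwiner from [sigma], and
    [isotypic sigma] is the least subspace containing these images. *)
Lemma isoproj_isotypic rho sigma f :
  f \in isotypic sigma -> isoproj rho f = (rho == sigma)%:R *: f.
Proof.
pose L := linfun (isoproj rho) - (rho == sigma)%:R *: \1%VF.
suff /subvP sub : (isotypic sigma <= lker L)%VS.
  by move/sub; rewrite memv_ker !lfun_simp /= subr_eq0 => /eqP.
apply: (isotypicP sigma).2 => W [phi [_ <- phiG]].
apply/subvP=> _ /memv_imgP[v _ ->].
rewrite memv_ker !lfun_simp /= subr_eq0 isoproj_lact -linearZ /=.
have -> : \sum_g chi rho g^-1 *: lact g (phi v)
    = phi ((\sum_g chi rho g^-1 *: irr_repr sigma g) *m v).
  rewrite mulmx_suml linear_sum; apply: eq_bigr => g _.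
  by rewrite -scalemxAl linearZ /= phiG.
by rewrite -linearZ /= scalemxAl chi_orthogonality mul_scalar_mx linearZ.
Qed.

Section Coefficients.
Variables (n : nat) (rG : mx_representation C G n) (k : 'I_n).

(** The inverse turns left multiplication by [rG g] on [v] into left translation
    of the function. *)
Definition coef_fun (v : 'cV[C]_n) : CG := [ffun x => (rG x^-1%g *m v) k 0].

Lemma coef_fun_is_linear : linear coef_fun.
Proof. by move=> a u v; apply/ffunP=> x; rewrite !ffunE linearP !mxE. Qed.

HB.instance Definition _ :=
  GRing.isLinear.Build C 'cV[C]_n CG *:%R coef_fun coef_fun_is_linear.

Lemma lact_coef_fun g v : lact g (coef_fun v) = coef_fun (rG g *m v).
Proof.
apply/ffunP=> x; rewrite !ffunE invMg invgK repr_mxM ?in_setT //.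
by rewrite mulmxA.
Qed.

(** The [k]-th row of the matrices [rG x] spans all the row vectors, because
    [rG] is irreducible; a vector killed by all these rows is 0. *)
Lemma coef_fun_eq0 v : mx_irreducible rG -> coef_fun v = 0 -> v = 0.
Proof.
move=> /mx_irrP[_ irr] /ffunP v0; pose e : 'rV[C]_n := delta_mx 0 k.
have full : row_full (cyclic_mx rG e).
  apply: irr; first exact: cyclic_mx_module.
  rewrite cyclic_mx_eq0; apply/eqP=> /rowP/(_ k)/eqP.
  by rewrite !mxE !eqxx oner_eq0.
suff /(submx_trans (_ : (1%:M <= _)%MS)) : (cyclic_mx rG e <= kermx v)%MS.
  by rewrite sub1mx full => /(_ isT)/sub_kermxP; rewrite mul1mx.
apply/row_subP => i.
have /cyclic_mxP[A /envelop_mxP[a ->] ->] := row_sub i (cyclic_mx rG e).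
apply/sub_kermxP; rewrite mulmx_sumr mulmx_suml big1 // => x _.
rewrite -scalemxAr -scalemxAl -mulmxA; apply/rowP=> j.
have := v0 x^-1%g; rewrite !ffunE invgK => xv0.
by rewrite -rowE ord1 mxE [row _ _ _ _]mxE xv0 mulr0 mxE.
Qed.

End Coefficients.

Lemma coef_fun_isotypic rho k v : coef_fun (irr_repr rho) k v \in isotypic rho.
Proof.
pose phi := linfun (coef_fun (irr_repr rho) k).
suff /(isotypicP rho).1/subvP sub : submodule_of_type rho (limg phi).
  by apply: sub; rewrite -[coef_fun _ k v]lfunE memv_img ?memvf.
exists phi; split=> // [|g u]; last by rewrite !lfunE lact_coef_fun.
apply/eqP; rewrite -subv0; apply/subvP=> u.
rewrite memv_ker lfunE memv0 => /eqP.
by move/(coef_fun_eq0 (socle_irr rho)) => ->.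
Qed.

(** Expanding [chi rho (y * x^-1)] as the trace of
    [irr_repr rho x^-1 *m irr_repr rho y] exhibits [isoproj rho f] as a
    combination of matrix coefficients. *)
Lemma isoproj_in_isotypic rho f : isoproj rho f \in isotypic rho.
Proof.
have -> : isoproj rho f = ((irr_degree rho)%:R / #|gT|%:R) *:
   \sum_y \sum_k f y *: coef_fun (irr_repr rho) k (col k (irr_repr rho y)).
  apply/ffunP=> x; rewrite !ffunE; congr (_ * _); rewrite sum_ffunE.
  apply: eq_bigr => y _; rewrite sum_ffunE mulrC.
  rewrite /chi repr_mxM ?in_setT // mxtrace_mulC mxtrace_mul_col mulr_sumr.
  by apply: eq_bigr => k _; rewrite !ffunE.
rewrite rpredZ // rpred_sum // => y _; rewrite rpred_sum // => k _.
by rewrite rpredZ // coef_fun_isotypic.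
Qed.

Lemma sum_isoproj f : \sum_(rho : dual R gT) isoproj rho f = f.
Proof.
apply/ffunP=> x; rewrite sum_ffunE.
under eq_bigr => rho _ do rewrite ffunE mulr_sumr.
rewrite exchange_big /= (bigD1 x) //= [X in _ + X]big1 => [|y ne_yx].
  under eq_bigr => rho _ do rewrite mulrA.
  by rewrite -mulr_suml mulgV chi_regular eqxx mul1r addr0.
under eq_bigr => rho _ do rewrite mulrA.
by rewrite -mulr_suml chi_regular -eq_mulgV1 (negPf ne_yx) mul0r.
Qed.

(** The operator [isoproj rho] extracts the [rho]-term of any decomposition of
    [f] along the isotypic subspaces, in particular of the one that defines
    [component]. *)
Lemma component_isoproj rho f : component rho f = isoproj rho f.
Proof.
have f_sum : f \in (\sum_(sigma : dual R gT) isotypic sigma)%VS.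
  rewrite -[f]sum_isoproj memv_sumr // => sigma _.
  exact: isoproj_in_isotypic.
have in_iso sigma : component sigma f \in isotypic sigma.
  exact: memv_sum_pi.
have sum_f : \sum_(sigma : dual R gT) component sigma f = f.
  exact: sumv_pi_sum erefl f_sum.
rewrite -[in RHS]sum_f linear_sum (bigD1 rho) //= big1 => [|sigma ne_sr].
  by rewrite addr0 (isoproj_isotypic rho (in_iso rho)) eqxx scale1r.
by rewrite (isoproj_isotypic rho (in_iso sigma)) eq_sym (negPf ne_sr) scale0r.
Qed.

(** The kernel [(x, y) |-> chi rho (y * x^-1)] is Hermitian, by [chiV]. *)
Lemma inner_isoproj rho f h : inner (isoproj rho f) h = inner f (isoproj rho h).
Proof.
rewrite /inner; under eq_bigr => x _ do rewrite ffunE mulr_sumr mulr_suml.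
rewrite exchange_big /=; apply: eq_bigr => y _.
rewrite ffunE rmorphM rmorph_sum /= mulr_sumr mulr_sumr; apply: eq_bigr => x _.
rewrite !rmorphM /= fmorphV /= !conjC_nat -chiV invMg invgK.
by ring.
Qed.

Lemma isoproj_idem rho f : isoproj rho (isoproj rho f) = isoproj rho f.
Proof.
by rewrite (isoproj_isotypic rho (isoproj_in_isotypic rho f)) eqxx scale1r.
Qed.

Lemma isoproj_trivial f : isoproj [1 dual R gT]%irr f = [ffun=> mean f].
Proof.
apply/ffunP=> x; rewrite !ffunE degree_irr1 /mean /mean_on cardsT.
rewrite mul1r; congr (_ * _); apply: eq_big => [y | y _]; first by rewrite inE.
rewrite /chi (irr1_repr (dual R gT) (in_setT _)).
by rewrite mxtrace1 degree_irr1 mul1r.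
Qed.

(** * The quadrature error *)

Definition indic Y : CG := [ffun x => (x \in Y)%:R].

Lemma mean_on_inner Y f : mean_on Y f = #|Y|%:R^-1 * inner f (indic Y).
Proof.
rewrite /mean_on /inner [\sum_(x in Y) _]big_mkcond; congr (_ * _).
apply: eq_bigr => x _; rewrite ffunE conjC_nat.
by case: (x \in Y); rewrite ?mulr1 ?mulr0.
Qed.

Lemma inner_isoproj_indic rho Y :
  inner (isoproj rho (indic Y)) (indic Y) =
    (irr_degree rho)%:R / #|gT|%:R
      * \sum_(x in Y) \sum_(y in Y) chi rho (x^-1 * y)%g.
Proof.
rewrite mulr_sumr /inner [RHS]big_mkcond /=; apply: eq_bigr => x _.
rewrite !ffunE conjC_nat; case: (x \in Y); last by rewrite mulr0.
rewrite mulr1; congr (_ * _); rewrite [RHS]big_mkcond /=.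
apply: eq_bigr => y _; rewrite ffunE; case: (y \in Y); rewrite ?mulr0 // mulr1.
exact: chiC.
Qed.

Lemma normf_isoproj_indic rho Y : Y != set0 ->
  normf (isoproj rho (indic Y)) = #|Y|%:R * boundary rho Y.
Proof.
move=> Y_neq0.
have cardY_neq0 : #|Y|%:R != 0 :> C by rewrite pnatr_eq0 cards_eq0.
have ReM (a : R) (z : C) : a * complex.Re z = complex.Re (a%:C * z).
  by case: z => u v /=; rewrite mul0r subr0.
rewrite /normf inner_isoproj isoproj_idem -inner_isoproj inner_isoproj_indic.
have -> : #|Y|%:R = Num.sqrt (#|Y|%:R ^+ 2) :> R.
  by rewrite sqrtr_sqr ger0_norm ?ler0n.
rewrite /boundary -sqrtrM ?sqr_ge0 //.
congr (Num.sqrt _); rewrite ReM rmorphXn rmorph_nat; congr complex.Re.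
by field; rewrite ?cardY_neq0 ?card_group_neq0.
Qed.

Lemma mean_component_le rho Y f : Y != set0 ->
  `|mean_on Y (component rho f)|
    <= (normf (component rho f) * boundary rho Y)%:C.
Proof.
move=> Y_neq0; have cardY_gt0 : 0 < #|Y|%:R :> C by rewrite ltr0n card_gt0.
rewrite mean_on_inner normrM normfV normr_nat ler_pdivrMl //.
rewrite component_isoproj -{1}isoproj_idem inner_isoproj.
apply: le_trans (inner_CauchySchwarz _ _) _.
by rewrite normf_isoproj_indic // mulrCA rmorphM rmorph_nat.
Qed.

Lemma mean_sub_mean_on Y f : Y != set0 ->
  mean f - mean_on Y f =
    - \sum_(rho : dual R gT | rho != [1 (dual R gT)]%irr)
        mean_on Y (component rho f).
Proof.
move=> Y_neq0.
have cardY_neq0 : #|Y|%:R != 0 :> C by rewrite pnatr_eq0 cards_eq0.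
have mean_const : mean_on Y [ffun=> mean f] = mean f.
  rewrite /mean_on; under eq_bigr do rewrite ffunE.
  by rewrite sumr_const -[mean f *+ _]mulr_natl mulKf.
have -> : mean_on Y f = \sum_(rho : dual R gT) mean_on Y (component rho f).
  rewrite -mulr_sumr exchange_big; congr (_ * _); apply: eq_bigr => x _.
  rewrite -[in LHS](sum_isoproj f) sum_ffunE.
  by apply: eq_bigr => rho _; rewrite component_isoproj.
rewrite (bigD1 [1 (dual R gT)]%irr) //= component_isoproj isoproj_trivial.
by rewrite mean_const opprD addNKr.
Qed.

End Isotypic.

Theorem corollary2 (R : realType) (gT : finGroupType) (Y : {set gT})
    (Y_neq0 : Y != set0) (f : fun_space R gT) :
  let S : R := \sum_(rho : dual R gT | rho != [1 (dual R gT)]%irr)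
                  normf (component rho f) * boundary rho Y in
  `|mean f - mean_on Y f| <= S%:C /\ S <= variation f * discrepancy R Y.
Proof.
move=> S; split.
  rewrite mean_sub_mean_on // normrN rmorph_sum.
  apply: le_trans (ler_norm_sum _ _ _) _; apply: ler_sum => rho _.
  exact: mean_component_le.
rewrite mulr_suml; apply: ler_sum => rho rho_neq1.
have degree_gt0 : 0 < (irr_degree rho)%:R :> R by rewrite ltr0n irr_degree_gt0.
rewrite -mulrA ler_wpM2l ?normf_ge0 // mulrC -ler_pdivrMr //.
exact: le_bigmax_cond.
Qed.
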